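(* Let $(X,T)$ be a topological dynamical system having a (one-sided or two-sided) horseshoe. Then $(X,T)$ is Bohr chaotic.
   Context: A topological dynamical system $(X,T)$ is a compact metric space $X$ together with a continuous map $T:X\to X$; $C(X)$ is the space of continuous complex-valued functions on $X$. A (non-trivial) weight is a bounded sequence of complex numbers $(w_n)_{n\ge 0}$ with $\limsup_{N\to\infty}\frac1N\sum_{n=0}^{N-1}|w_n|>0$. The system $(X,T)$ is Bohr chaotic if for every non-trivial weight $(w_n)_{n\ge0}$ there exist $f\in C(X)$ and $x\in X$ such that $\limsup_{N\to\infty}\frac1N\left|\sum_{n=0}^{N-1}w_nf(T^nx)\right|>0$. The system $(X,T)$ admits a two-sided (resp. one-sided) horseshoe if there are an integer $N\ge1$ and a closed set $\Lambda\subset X$ with $T^N(\Lambda)\subset\Lambda$ such that $(\Lambda,T^N)$ is topologically conjugate to the two-sided full shift $(\{0,1\}^{\mathbb Z},\sigma)$ (resp. the one-sided full shift $(\{0,1\}^{\mathbb N},\sigma)$, $\mathbb N=\{0,1,2,\dots\}$), where $\sigma$ is the shift $(x_n)\mapsto(x_{n+1})$. *)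

(* Defs.v *)
From HB Require Import structures.
From mathcomp Require Import all_boot all_order all_algebra.
From mathcomp Require Import all_classical all_reals all_analysis.
From mathcomp Require Import complex.

Set Implicit Arguments.
Unset Strict Implicit.
Unset Printing Implicit Defensive.

Import Order.TTheory GRing.Theory Num.Theory.
Import numFieldNormedType.Exports.

Local Open Scope classical_set_scope.
Local Open Scope ring_scope.

(* The modulus is taken as the R-valued [normc], because the generic norm of
   R[i] takes its values in R[i]. The topology of C is that of R[i]^o. *)
Notation cmod := ComplexField.Normc.normc.

Definition topological_dynamical_system (R : realType) (X : metricType R)
    (T : X -> X) : Prop :=
  compact [set: X] /\ continuous T.

Definition nontrivial_weight (R : realType) (w : nat -> R[i]) : Prop :=
  (exists M : R, forall n, cmod (w n) <= M) /\
  (0 < limn_esup (fun N => (N%:R^-1 * \sum_(0 <= n < N) cmod (w n))%:E))%E.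

Definition Bohr_chaotic (R : realType) (X : metricType R) (T : X -> X) : Prop :=
  forall w : nat -> R[i], nontrivial_weight w ->
  exists (f : X -> R[i]^o) (x : X),
    continuous f /\
    (0 < limn_esup (fun N =>
       (N%:R^-1 * cmod (\sum_(0 <= n < N) w n * f (iter n T x)))%:E))%E.

(* (A, S) is conjugate to (Y, U): h restricts to a homeomorphism from A, with
   its subspace topology, onto Y, with inverse g, and intertwines S and U.
   The values of h outside A are irrelevant. *)
Definition topologically_conjugate (X Y : topologicalType)
    (A : set X) (S : X -> X) (U : Y -> Y) : Prop :=
  exists (h : X -> Y) (g : Y -> X),
    [/\ {within A, continuous h},
        continuous g /\ (forall y, A (g y)),
        forall x, A x -> g (h x) = x,
        forall y, h (g y) = y &
        forall x, A x -> h (S x) = U (h x)].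

Definition two_sided_sequences : topologicalType :=
  prod_topology (fun _ : int => bool).

Definition two_sided_shift (x : two_sided_sequences) : two_sided_sequences :=
  fun n : int => x (n + 1).

Definition one_sided_sequences : topologicalType :=
  prod_topology (fun _ : nat => bool).

Definition one_sided_shift (x : one_sided_sequences) : one_sided_sequences :=
  fun n : nat => x n.+1.

Definition horseshoe_for (X Y : topologicalType) (T : X -> X) (U : Y -> Y)
    : Prop :=
  exists (N : nat) (Lambda : set X),
    [/\ (1 <= N)%N, closed Lambda, iter N T @` Lambda `<=` Lambda &
        topologically_conjugate Lambda (iter N T) U].

Definition has_two_sided_horseshoe (X : topologicalType) (T : X -> X) : Prop :=
  horseshoe_for T two_sided_shift.

Definition has_one_sided_horseshoe (X : topologicalType) (T : X -> X) : Prop :=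
  horseshoe_for T one_sided_shift.

(* Main.v *)
(* Let T^m act on the horseshoe as the shift, and let z be the point with the
   single symbol 1 at coordinate 0. It is homoclinic to the fixed point p of T^m
   coded by the zero sequence, and it is not T-periodic, so it is at positive
   distance from the rest of its T-orbit (including the coded past) and from
   the T-orbit of p. A bump function at z therefore detects, along the T-orbit of
   a point coded by very sparse 1s, exactly the times m a with a 1 at a. Hence
   every set of times inside one residue class mod P is the trace of some orbit.
   Given a weight, by pigeonhole one residue class and one of the positive parts
   of Re w, - Re w, Im w, - Im w carry positive upper density; selecting exactly
   these times leaves a sum without cancellation. *)
Require Import Defs.
From mathcomp Require Import all_boot all_order all_algebra.
From mathcomp Require Import all_classical all_reals all_analysis.
From mathcomp Require Import complex.
From mathcomp Require Import zify lra.

Set Implicit Arguments.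
Unset Strict Implicit.
Unset Printing Implicit Defensive.

Import Order.TTheory GRing.Theory Num.Theory.
Import numFieldNormedType.Exports.

Local Open Scope classical_set_scope.
Local Open Scope ring_scope.

(** * Positive upper limits and neighbourhoods in the shift space *)

Lemma limn_esup_gt0P (R : realType) (u : nat -> R) :
  (0 < limn_esup (fun n => (u n)%:E))%E <->
  exists2 c : R, 0 < c & forall n, exists2 k, (n <= k)%N & c <= u k.
Proof.
set v := fun n => (u n)%:E; rewrite limn_esup_lim; split=> [lim_gt0|[c c0 cu]].
  (* A [c] strictly below the limit lies strictly below every tail supremum, hence below some term
     of every tail. An infinite limit is allowed, and then [c = 1] serves. *)
  have [c c0 clim] : exists2 c : R, 0 < c & (c%:E < limn (esups v))%E.
    case: (limn _) lim_gt0 => [l| |] //; last by exists 1 => //; exact: ltry.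
    rewrite lte_fin => l0; exists (l / 2); first exact: divr_gt0.
    by rewrite lte_fin ltr_pdivrMr //; lra.
  exists c => // n.
  have : (c%:E < esups v n)%E.
    apply: lt_le_trans clim _; apply: lime_le; first exact: is_cvg_esups.
    by exists n => // m /= nm; exact: nonincreasing_esups.
  move=> /ereal_sup_gt[_ [k /= nk <-]]; rewrite lte_fin => /ltW ck.
  by exists k.
apply: (@lt_le_trans _ _ c%:E); first by rewrite lte_fin.
apply: lime_ge; first exact: is_cvg_esups.
apply: nearW => n; have [k nk ck] := cu n.
apply: (@le_trans _ _ (v k)); first by rewrite lee_fin.
by apply: ereal_sup_ubound; exists k.
Qed.

Lemma cvg_two_sided (u : nat -> two_sided_sequences) (y : two_sided_sequences) :
  (forall i, \forall n \near \oo, u n i = y i) -> u @ \oo --> y.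
Proof.
move=> uy; apply/cvg_sup => i A.
case=> B [[C oC <-] /= Cyi] CA.
apply: filterS (uy i) => n /= ui; apply: CA => /=.
by rewrite /proj ui.
Qed.

(** Otherwise every window has a counterexample, and these converge coordinatewise to [y] while
    avoiding [A]. *)
Lemma two_sided_nbhs (A : set two_sided_sequences) (y : two_sided_sequences) :
  nbhs y A ->
  exists n : nat, forall y' : two_sided_sequences,
    (forall i : int, (`|i| < n)%N -> y' i = y i) -> A y'.
Proof.
move=> yA; apply: contrapT => /forallNP noA.
have /choice[u uP] : forall n, exists y' : two_sided_sequences,
    (forall i : int, (`|i| < n)%N -> y' i = y i) /\ ~ A y'.
  move=> n; have /existsNP[y' /not_implyP ?] := noA n; by exists y'.
have : u @ \oo --> y.
  apply: cvg_two_sided => i; exists `|i|.+1%N => // n /= ni.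
  by have [+ _] := uP n; exact.
move=> /(_ A yA)[n _ /(_ n (leqnn n))].
by have [_ +] := uP n.
Qed.

Lemma one_sided_restriction_continuous :
  continuous ((fun y n => y n%:Z) : two_sided_sequences -> one_sided_sequences).
Proof.
move=> y; apply/cvg_sup => n A [B [[C oC <-] /= Cyn] CA].
have yC : nbhs y [set z : two_sided_sequences | C (z n%:Z)].
  apply: (@proj_continuous _ (fun _ : int => (bool : topologicalType)) n%:Z y C).
  exact: open_nbhs_nbhs.
by apply: (filterS _ yC) => z Cz; exact: CA.
Qed.

(** * The homoclinic point and its orbit *)

Definition unit_sequence (k : int) : two_sided_sequences := fun i => i == k.

Definition zero_sequence : two_sided_sequences := fun=> false.

Lemma iter_two_sided_shift (a : nat) (y : two_sided_sequences) :
  iter a two_sided_shift y = fun i => y (i + a%:Z).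
Proof.
elim: a => [|a IHa]; first by apply/funext => i /=; rewrite addr0.
rewrite iterS IHa; apply/funext => i; rewrite /two_sided_shift.
by congr y; lia.
Qed.

Lemma iter_shift_unit_sequence (a : nat) (k : int) :
  iter a two_sided_shift (unit_sequence k) = unit_sequence (k - a%:Z).
Proof.
by rewrite iter_two_sided_shift; apply/funext => i; apply/eqP/eqP; lia.
Qed.

Lemma iter_equivariant (X : Type) (T : X -> X) (m a : nat)
    (G : two_sided_sequences -> X) (y : two_sided_sequences) :
  (forall y, G (two_sided_shift y) = iter m T (G y)) ->
  G (iter a two_sided_shift y) = iter (m * a) T (G y).
Proof.
move=> GT; elim: a => [|a IHa]; first by rewrite muln0.
by rewrite iterS GT IHa -iterD mulnS.
Qed.

Lemma iter_mul_fix (X : Type) (f : X -> X) (n a : nat) (x : X) :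
  iter n f x = x -> iter (a * n) f x = x.
Proof. by move=> fx; elim: a => // a IHa; rewrite mulSn iterD IHa. Qed.

Section Homoclinic.
Variables (X : Type) (T : X -> X) (m : nat) (G : two_sided_sequences -> X).
Hypothesis m_gt0 : (0 < m)%N.
Hypothesis GT : forall y, G (two_sided_shift y) = iter m T (G y).
Hypothesis G_unit :
  forall q : nat, (0 < q)%N -> G (unit_sequence (- q%:Z)) <> G (unit_sequence 0).

(** A point of period [q] is also fixed by [m * q] steps, but these move the symbol 1 to coordinate
    [- q], against [G_unit]. *)
Lemma homoclinic_not_periodic (q : nat) :
  (0 < q)%N -> iter q T (G (unit_sequence 0)) <> G (unit_sequence 0).
Proof.
move=> q0 z0q; have := iter_mul_fix m z0q; rewrite -iter_equivariant //.
by rewrite iter_shift_unit_sequence sub0r; exact: G_unit.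
Qed.

(** For [k > 0] the point reaches z after [m * k] steps, so reaching it after [j < m] steps already
    would give z the period [m * k - j]. For [k < 0] it lies on the forward orbit of z, and for
    [k = 0] it is z, with [j] as a period. *)
Lemma homoclinic_orbit_unit (j : nat) (k : int) :
  (j < m)%N -> (j != 0%N) || (k != 0) ->
  iter j T (G (unit_sequence k)) <> G (unit_sequence 0).
Proof.
move=> jm jk; case: k jk => [k|k] jk.
  have yk : iter (m * k) T (G (unit_sequence k)) = G (unit_sequence 0).
    by rewrite -iter_equivariant // iter_shift_unit_sequence subrr.
  move=> jk0; case: k => [|k] in jk yk jk0.
    by apply: (@homoclinic_not_periodic j) => //; case: j jk {jk0 jm}.
  have jmk : (j < m * k.+1)%N by rewrite mulnS; lia.
  apply: (@homoclinic_not_periodic (m * k.+1 - j)); first by rewrite subn_gt0.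
  by rewrite -{1}jk0 -iterD subnK // ltnW.
have -> : G (unit_sequence (Negz k)) = iter (m * k.+1) T (G (unit_sequence 0)).
  by rewrite -iter_equivariant // iter_shift_unit_sequence sub0r NegzE.
rewrite -iterD; apply: homoclinic_not_periodic.
by rewrite addn_gt0 muln_gt0 m_gt0 orbT.
Qed.

(** The orbit of the fixed point consists of points fixed by [m] steps, and z is not one of them. *)
Lemma homoclinic_orbit_zero (j : nat) :
  iter j T (G zero_sequence) <> G (unit_sequence 0).
Proof.
move=> j0; apply: (homoclinic_not_periodic m_gt0).
by rewrite -j0 -iterD addnC iterD -(GT zero_sequence).
Qed.

End Homoclinic.

(** * Separation by windows and the bump function *)

Lemma exists_uniform (K : nat) (Q : nat -> nat -> Prop) :
  (forall i n n', (n <= n')%N -> Q i n -> Q i n') ->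
  (forall i, (i < K)%N -> exists n, Q i n) ->
  exists n, forall i, (i < K)%N -> Q i n.
Proof.
move=> Qmono; elim: K => [|K IHK] QK; first by exists 0%N.
have [n nQ] := IHK (fun i iK => QK i (ltnW iK)).
have [n' n'Q] := QK K (ltnSn K).
exists (maxn n n') => i; rewrite ltnS leq_eqVlt => /orP[/eqP ->|iK].
  by apply: Qmono n'Q; exact: leq_maxr.
by apply: Qmono (nQ i iK); exact: leq_maxl.
Qed.

Lemma iter_continuous (X : topologicalType) (T : X -> X) (j : nat) :
  continuous T -> continuous (iter j T).
Proof.
move=> cT; elim: j => [|j IHj] x; first exact: cvg_id.
exact: (continuous_comp (IHj x) (cT _)).
Qed.

Lemma mdist_continuous (R : realType) (X : metricType R) (z : X) :
  continuous (mdist z : X -> R).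
Proof.
move=> x; apply/cvgrPdist_lt => e e0.
near=> y.
have dxy : mdist x y < e.
  near: y; rewrite !near_simpl.
  have := nbhsx_ballx x e e0.
  by rewrite /= ballEmdist; apply: filterS.
have := metric_triangle z x y; have := metric_triangle z y x.
rewrite (metric_sym y x) ltr_norml => h1 h2; lra.
Unshelve. all: by end_near. Qed.

(* One n controls both the window and the distance, so that the property is
   monotone in n and finitely many instances can be made uniform. *)
Definition window_separated (R : realType) (X : metricType R)
    (F : two_sided_sequences -> X) (z : X) (y : two_sided_sequences)
    (n : nat) : Prop :=
  forall y' : two_sided_sequences,
    (forall i : int, (`|i| < n)%N -> y' i = y i) -> n.+1%:R^-1 < mdist z (F y').

Lemma window_separated_mono (R : realType) (X : metricType R)
    (F : two_sided_sequences -> X) (z : X) (y : two_sided_sequences)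
    (n n' : nat) :
  (n <= n')%N -> window_separated F z y n -> window_separated F z y n'.
Proof.
move=> nn' sep y' yy'; apply: (@le_lt_trans _ _ n.+1%:R^-1).
  by rewrite lef_pV2 ?posrE ?ltr0n// ler_nat.
by apply: sep => i ni; apply: yy'; exact: leq_trans nn'.
Qed.

Lemma exists_window_separated (R : realType) (X : metricType R)
    (F : two_sided_sequences -> X) (z : X) (y : two_sided_sequences) :
  continuous F -> F y <> z -> exists n, window_separated F z y n.
Proof.
move=> cF /eqP; rewrite eq_sym -mdist_gt0 => d0.
have /two_sided_nbhs[n nP] : nbhs y [set y' | mdist z (F y) / 2 < mdist z (F y')].
  have /cvgr_gt := continuous_comp (cF y) (@mdist_continuous _ _ z (F y)).
  by apply; rewrite ltr_pdivrMr //=; lra.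
pose k := Num.truncn (mdist z (F y) / 2)^-1.
exists (maxn n k) => y' yy'.
have /= : mdist z (F y) / 2 < mdist z (F y').
  by apply: nP => i ni; apply: yy'; rewrite leq_max ni.
apply: lt_trans; rewrite invf_plt ?posrE ?divr_gt0 //.
by apply: lt_le_trans (truncnS_gt _) _; rewrite ler_nat ltnS leq_maxr.
Qed.

Definition sparse (L : nat) (y : two_sided_sequences) : Prop :=
  forall a b : int, y a -> y b -> a != b -> (L <= `|a - b|)%N.

(** Three nested windows are used. Without a 1 in window [n0], the sequence looks like zero and its
    image stays away from z. With a 1 at [k] in window [n0], sparsity makes it look like
    [unit_sequence k] on window [n2]: this keeps the image away from z, or brings it close when [j]
    and [k] vanish. *)
Lemma sparse_detector (R : realType) (X : metricType R) (T : X -> X) (m : nat)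
    (G : two_sided_sequences -> X) :
  continuous T -> continuous G -> (0 < m)%N ->
  (forall y, G (two_sided_shift y) = iter m T (G y)) ->
  (forall q : nat, (0 < q)%N ->
     G (unit_sequence (- q%:Z)) <> G (unit_sequence 0)) ->
  exists (f : X -> R) (L : nat),
    [/\ continuous f, (0 < L)%N &
        forall (y : two_sided_sequences) (j : nat), sparse L y -> (j < m)%N ->
          f (iter j T (G y)) = ((j == 0%N) && y 0)%:R].
Proof.
move=> cT cG m0 GT G_unit; set z := G (unit_sequence 0).
have cF j : continuous (iter j T \o G).
  by move=> y; apply: continuous_comp; [exact: cG|exact: iter_continuous].
have [n0' n0'P] : exists n, forall j, (j < m)%N ->
    window_separated (iter j T \o G) z zero_sequence n.
  apply: exists_uniform => [j n n'|j jm]; first exact: window_separated_mono.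
  by apply: exists_window_separated => //; exact: (homoclinic_orbit_zero (m := m)).
(* The successor puts coordinate 0 inside the window and makes the gap [n2 + n2] positive. *)
pose n0 := n0'.+1.
have n0P j : (j < m)%N -> window_separated (iter j T \o G) z zero_sequence n0.
  by move=> jm; apply: window_separated_mono (n0'P j jm).
(* The guard excludes only z itself, so that all pairs can be made uniform together. *)
pose sep j k n := (j != 0%N) || (k != 0 :> int) ->
  window_separated (iter j T \o G) z (unit_sequence k) n.
have sep_mono j k n n' : (n <= n')%N -> sep j k n -> sep j k n'.
  by move=> nn' sjk jk; apply: window_separated_mono nn' (sjk jk).
have sep_ex j k : (j < m)%N -> exists n, sep j k n.
  move=> jm; have [jk|jk] := boolP ((j != 0%N) || (k != 0 :> int)); last first.
    by exists 0%N => /(negP jk).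
  have [n nP] := exists_window_separated (cF j)
    (homoclinic_orbit_unit m0 GT G_unit jm jk).
  by exists n.
have [n1' n1'P] : exists n, forall j, (j < m)%N -> forall i, (i < n0)%N ->
    sep j i%:Z n /\ sep j (- i%:Z) n.
  apply: exists_uniform => [j n n' nn' H i /H[]|j jm].
    by move=> s1 s2; split; exact: sep_mono nn' _.
  apply: exists_uniform => [i n n' nn' [s1 s2]|i _].
    by split; exact: sep_mono nn' _.
  have [n nP] := sep_ex j i%:Z jm; have [n' n'P] := sep_ex j (- i%:Z) jm.
  exists (maxn n n'); split.
    by apply: sep_mono nP; exact: leq_maxl.
  by apply: sep_mono n'P; exact: leq_maxr.
pose n1 := maxn n0 n1'.
have n1P j k : (j < m)%N -> (`|k| < n0)%N -> sep j k n1.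
  move=> jm kn0; apply: (@sep_mono _ _ n1'); first exact: leq_maxr.
  have [s1 s2] := n1'P j jm _ kn0.
  by have [->|->] : k = `|k|%N%:Z \/ k = - `|k|%N%:Z by lia.
have [n2' n2'P] : exists n : nat, forall y' : two_sided_sequences,
    (forall i : int, (`|i| < n)%N -> y' i = unit_sequence 0 i) ->
    mdist z (G y') < (n1.+1%:R *+ 2)^-1.
  apply: two_sided_nbhs.
  have /cvgr_lt := continuous_comp (cG (unit_sequence 0)) (@mdist_continuous _ _ z z).
  by apply; rewrite /= mdistxx invr_gt0 pmulrn_lgt0.
pose n2 := maxn n1 n2'.
(* A plateau of height 1 up to distance 1/(2(n1+1)) from z, then linear down to 0 at distance
   1/(n1+1). *)
pose f x : R := Num.max 0 (Num.min 1 (2 - n1.+1%:R *+ 2 * mdist z x)).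
have f0 x : n1.+1%:R^-1 < mdist z x -> f x = 0.
  rewrite -[_^-1]mul1r ltr_pdivrMr ?ltr0n // => H.
  by rewrite /f; apply: max_l; rewrite ge_min; apply/orP; right; lra.
have f1 x : mdist z x < (n1.+1%:R *+ 2)^-1 -> f x = 1.
  rewrite -[_^-1]mul1r ltr_pdivlMr ?pmulrn_lgt0 ?ltr0n // => H.
  by rewrite /f min_l ?max_r //; lra.
exists f, (n2 + n2)%N; split; first last.
- move=> y j spy jm.
  have [[k kn0 yk]|yk] :=
      pselect (exists2 k : int, (`|k| < n0)%N & y k); last first.
    have y0 : y 0 = false by apply/negP => y0; apply: yk; exists 0.
    rewrite y0 andbF; apply: f0.
    apply: (@le_lt_trans _ _ n0.+1%:R^-1).
      by rewrite lef_pV2 ?posrE ?ltr0n// ler_nat ltnS leq_maxl.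
    apply: (n0P j jm) => i ni; apply/negP => yi.
    by apply: yk; exists i.
  (* Both [i] and [k] lie in window [n2], so their distance is below [n2 + n2] and sparsity forbids
     a second 1. *)
  have yw i : (`|i| < n2)%N -> y i = unit_sequence k i.
    move=> ni; rewrite /unit_sequence; have [->//|ik] := eqVneq i k.
    apply/negP => yi; have := spy _ _ yi yk ik.
    by move: ni kn0; rewrite /n2 /n1; lia.
  have [jk|] := boolP ((j != 0%N) || (k != 0 :> int)).
    rewrite f0; last first.
      by apply: (n1P j k jm kn0 jk) => i ni; apply: yw; rewrite /n2; lia.
    move: jk; case: eqP => //= _ k0; suff -> : y 0 = false by [].
    apply/negP => y0; have := spy _ _ yk y0 k0.
    by move: kn0; rewrite /n2 /n1; lia.
  rewrite negb_or !negbK => /andP[/eqP -> /eqP k0].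
  rewrite k0 in yk yw; rewrite yk /= f1 //; apply: n2'P => i ni.
  by apply: yw; rewrite /n2; lia.
- by rewrite addn_gt0 /n2 /n1 /n0; lia.
- move=> x; apply: (@continuous_max R X (fun=> 0)
    (fun x => Num.min 1 (2 - n1.+1%:R *+ 2 * mdist z x))); first exact: cvg_cst.
  apply: (@continuous_min R X (fun=> 1)
    (fun x => 2 - n1.+1%:R *+ 2 * mdist z x)); first exact: cvg_cst.
  apply: cvgB; first exact: cvg_cst.
  apply: cvgM; first exact: cvg_cst.
  exact: mdist_continuous.
Qed.

(** * Orbits with prescribed visiting times *)

Lemma sparse_iter_shift (L a : nat) (y : two_sided_sequences) :
  sparse L y -> sparse L (iter a two_sided_shift y).
Proof.
rewrite iter_two_sided_shift => spy b c yb yc bc.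
have := spy _ _ yb yc; rewrite (inj_eq (addIr _)) => /(_ bc); lia.
Qed.

(** With [P = m * L], multiples of [P] in T-time are multiples of [L] in shift time, so coding them
    by 1s gives a sparse sequence. A delay of [P - r] moves the class of [r] onto these
    multiples. *)
Lemma residue_detector (R : realType) (X : metricType R) (T : X -> X) (m : nat)
    (G : two_sided_sequences -> X) :
  continuous T -> continuous G -> (0 < m)%N ->
  (forall y, G (two_sided_shift y) = iter m T (G y)) ->
  (forall q : nat, (0 < q)%N ->
     G (unit_sequence (- q%:Z)) <> G (unit_sequence 0)) ->
  exists (f : X -> R) (P : nat),
    [/\ continuous f, (0 < P)%N &
        forall (r : nat) (S : pred nat), (r < P)%N ->
          (forall n, S n -> (n %% P)%N = r) ->
          exists x, forall n, f (iter n T x) = (S n)%:R].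
Proof.
move=> cT cG m0 GT G_unit.
have [f [L [cf L0 fP]]] := sparse_detector cT cG m0 GT G_unit.
exists f, (m * L)%N; split=> //; first by rewrite muln_gt0 m0.
move=> r S rP SP; set P := (m * L)%N in rP SP *.
have Smul n : S n -> (n + (P - r) = m * ((n %/ P).+1 * L))%N.
  move=> /SP nr; rewrite {1}(divn_eq n P) nr -addnA subnKC; last exact: ltnW.
  by rewrite mulnCA -/P mulSn addnC.
(* The inequality guards the truncated subtraction, which would otherwise send early coordinates to
   time 0. *)
pose y : two_sided_sequences := fun i =>
  if i is Posz a then (P - r <= m * a)%N && S (m * a - (P - r))%N else false.
have spy : sparse L y.
  have yL i : y i -> exists q : nat, i = (q * L)%:Z.
    case: i => // a /andP[ra /Smul]; rewrite subnK // => /eqP.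
    rewrite eqn_pmul2l // => /eqP ->.
    by eexists.
  move=> a b /yL[p ->] /yL[q ->] pq.
  have {}pq : p != q by apply: contra pq => /eqP ->.
  have [pltq|qltp] : (p < q)%N \/ (q < p)%N by lia.
    have : (p.+1 * L <= q * L)%N by rewrite leq_mul2r pltq orbT.
    by rewrite mulSn; lia.
  have : (q.+1 * L <= p * L)%N by rewrite leq_mul2r qltp orbT.
  by rewrite mulSn; lia.
exists (iter (P - r) T (G y)) => n.
(* Euclidean division of the delayed time by [m] gives the number of shifts and the remaining
   [j < m] steps. *)
rewrite -iterD [X in iter X](divn_eq _ m) addnC iterD mulnC -iter_equivariant //.
rewrite fP ?ltn_mod //; last exact: sparse_iter_shift.
congr (nat_of_bool _)%:R.
rewrite iter_two_sided_shift add0r /y.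
case: eqP => [jm|jm] /=.
  have -> : (m * ((n + (P - r)) %/ m) = n + (P - r))%N.
    by rewrite mulnC divnK // /dvdn jm.
  by rewrite leq_addl addnK.
by apply/esym/negP => /Smul nm; apply: jm; rewrite nm modnMr.
Qed.

(** * From horseshoes to maps on the two-sided shift *)

Lemma horseshoe_embedding (X Y : topologicalType) (T : X -> X) (U : Y -> Y) :
  horseshoe_for T U ->
  exists (m : nat) (g : Y -> X),
    [/\ (0 < m)%N, continuous g, injective g &
        forall y, g (U y) = iter m T (g y)].
Proof.
move=> [m [Lam [m0 _ TLam [h [g [_ [cg Lamg] hK gK hT]]]]]].
exists m, g; split=> //; first exact: can_inj gK.
move=> y; rewrite -[X in U X]gK -hT // hK //.
by apply: TLam; exists (g y).
Qed.

(* For a one-sided horseshoe, G forgets the negative coordinates and is not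
   injective; the last clause still holds, since a 1 at - q is then invisible. *)
Lemma horseshoe_two_sided_map (X : topologicalType) (T : X -> X) :
  has_one_sided_horseshoe T \/ has_two_sided_horseshoe T ->
  exists (m : nat) (G : two_sided_sequences -> X),
    [/\ (0 < m)%N, continuous G,
        forall y, G (two_sided_shift y) = iter m T (G y) &
        forall q : nat, (0 < q)%N ->
          G (unit_sequence (- q%:Z)) <> G (unit_sequence 0)].
Proof.
move=> [] /horseshoe_embedding [m [g [m0 cg injg gT]]].
  exists m, (fun y => g (fun n => y n%:Z)); split=> //.
  - move=> y; exact: (continuous_comp (@one_sided_restriction_continuous y) (cg _)).
  - move=> y; rewrite -gT; congr g; apply/funext => n.
    by rewrite /two_sided_shift /one_sided_shift; congr y; lia.
  - move=> q q0 /injg /(congr1 (fun s => s 0%N)).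
    by rewrite /unit_sequence eqxx => /eqP; lia.
exists m, g; split=> // q q0 /injg /(congr1 (fun s => s 0)).
by rewrite /unit_sequence eqxx => /eqP; lia.
Qed.

(** * Selecting a sign and a residue class *)

(** The four functionals Re, - Re, Im, - Im. Positivity is imposed separately, by selecting times,
    so that each of them stays additive. *)
Definition signed_part (R : realType) (t : bool * bool) (z : R[i]) : R :=
  (-1) ^+ t.2 * (if t.1 then complex.Re z else complex.Im z).

Lemma signed_partD (R : realType) (t : bool * bool) :
  {morph @signed_part R t : z z' / z + z'}.
Proof. by move=> [a b] [c d]; rewrite /signed_part -mulrDr; case: t.1. Qed.

Lemma signed_part0 (R : realType) (t : bool * bool) : signed_part t (0 : R[i]) = 0.
Proof. by rewrite /signed_part; case: t.1; rewrite mulr0. Qed.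

Lemma signed_part_mulb (R : realType) (t : bool * bool) (z : R[i]) (b : bool) :
  signed_part t (z * (b%:R : R)%:C%C) = signed_part t z *+ b.
Proof. by case: b; rewrite ?mulr1 ?mulr1n // mulr0 signed_part0. Qed.

Lemma signed_part_le_cmod (R : realType) (t : bool * bool) (z : R[i]) :
  signed_part t z <= cmod z.
Proof.
case: z => a b; apply: le_trans (ler_norm _) _.
rewrite /signed_part normrM normrX normrN1 expr1n mul1r -sqrtr_sqr /=.
by case: t.1; rewrite ler_wsqrtr // ?lerDl ?lerDr sqr_ge0.
Qed.

(** The positive parts of x and - x add up to the absolute value of x, and the modulus is at most
    |Re z| + |Im z|. *)
Lemma cmod_le_signed_parts (R : realType) (z : R[i]) :
  cmod z <= \sum_(t : bool * bool) signed_part t z *+ (0 < signed_part t z)%R.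
Proof.
have absE (x : R) : `|x| = x *+ (0 < x)%R + (- x) *+ (0 < - x)%R.
  rewrite oppr_gt0; case: ltgtP => [x0|x0|<-]; last by rewrite normr0 addr0.
    by rewrite gtr0_norm // addr0.
  by rewrite ltr0_norm // add0r.
rewrite -(pair_bigA _ (fun b1 b2 => signed_part (b1, b2) z *+
  (0 < signed_part (b1, b2) z)%R)) /= !big_bool /= /signed_part /=.
rewrite !expr0 !expr1 !mul1r !mulN1r.
rewrite [X in X + _]addrC [X in _ + X]addrC -!absE.
case: z => a b /=; rewrite -[leRHS]ger0_norm ?addr_ge0 // -sqrtr_sqr.
rewrite ler_wsqrtr // sqrrD !real_normK ?num_real //.
by rewrite lerD2r lerDl mulrn_wge0 // mulr_ge0.
Qed.

Lemma le_cmod_sum_signed_part (R : realType) (t : bool * bool) (w : nat -> R[i])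
    (S : pred nat) (N : nat) :
  \sum_(0 <= n < N) signed_part t (w n) *+ S n <=
  cmod (\sum_(0 <= n < N) w n * ((S n)%:R : R)%:C%C).
Proof.
apply: le_trans (signed_part_le_cmod t _).
rewrite (big_morph _ (@signed_partD R t) (signed_part0 R t)).
by under [leRHS]eq_bigr do rewrite signed_part_mulb.
Qed.

Lemma limn_esup_sum_gt0 (R : realType) (I : finType) (u : nat -> R)
    (v : I -> nat -> R) :
  (forall n, u n <= \sum_i v i n) -> (0 < limn_esup (fun n => (u n)%:E))%E ->
  exists i, (0 < limn_esup (fun n => (v i n)%:E))%E.
Proof.
move=> uv /limn_esup_gt0P[c c0 cu]; apply: contrapT => /forallNP vn.
(* Terms below [e] sum to at most c|I|/(|I|+1), which is less than [c]; the successor also covers an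
   empty [I]. *)
pose e := c / #|I|.+1%:R.
have e0 : 0 < e by rewrite divr_gt0.
have : \forall n \near \oo, forall i, v i n < e.
  apply: filter_forall => i; apply: contrapT => nv; apply: (vn i).
  apply/limn_esup_gt0P; exists e => // n; apply: contrapT => nk; apply: nv.
  exists n => // k /= nk'; rewrite ltNge; apply/negP => ek; apply: nk.
  by exists k.
move=> [n _ nP]; have [k nk ck] := cu n.
have : c <= \sum_(i : I) e.
  apply: le_trans ck (le_trans (uv k) _).
  by apply: ler_sum => i _; apply: ltW; apply: nP.
rewrite sumr_const -[e *+ _]mulr_natr mulrAC ler_pdivlMr ?ltr0n //.
by rewrite ler_pM2l // ler_nat ltnn.
Qed.

Lemma nontrivial_weight_residue (R : realType) (w : nat -> R[i]) (P : nat) :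
  (0 < P)%N -> nontrivial_weight w ->
  exists (r : 'I_P) (t : bool * bool), (0 < limn_esup (fun N =>
    (N%:R^-1 * \sum_(0 <= n < N)
      signed_part t (w n) *+ [&& (n %% P)%N == r & (0 < signed_part t (w n))%R])%:E))%E.
Proof.
move=> P0 [_ w0].
have [|[r t] rt] := @limn_esup_sum_gt0 R ('I_P * (bool * bool))%type _
    (fun rt N => N%:R^-1 * \sum_(0 <= n < N) signed_part rt.2 (w n) *+
      [&& (n %% P)%N == rt.1 & (0 < signed_part rt.2 (w n))%R]) _ w0; last first.
  by exists r, t.
move=> N; rewrite -mulr_sumr ler_wpM2l ?invr_ge0 // exchange_big /=.
apply: ler_sum => n _.
rewrite -(pair_bigA _ (fun (r : 'I_P) t => signed_part t (w n) *+
      [&& (n %% P)%N == r & (0 < signed_part t (w n))%R])) /=.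
(* The class of [n] alone already dominates the modulus of [w n]; the other classes contribute
   nonnegative terms. *)
rewrite (bigD1 (Ordinal (ltn_pmod n P0))) //= eqxx /=.
apply: le_trans (cmod_le_signed_parts _) _.
rewrite lerDl; apply: sumr_ge0 => r _; apply: sumr_ge0 => t _.
by case: ltP => [/ltW s0|_]; rewrite ?andbF ?mulr0n // mulrn_wge0.
Qed.

(** * Complex-valued observables and the conclusion *)

Lemma real_complex_continuous (R : realType) :
  continuous ((fun a : R => a%:C%C) : R -> R[i]^o).
Proof.
move=> a; apply/cvgrPdist_lt => e e0.
(* A positive element of [R[i]] is real, so the estimate can be made in [R]. *)
have eE : e = (complex.Re e)%:C%C by rewrite RRe_real // gtr0_real.
have re0 : 0 < complex.Re e by rewrite -ltcR -eE.
near=> b.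
have ab : `|a - b| < complex.Re e by near: b; exact: cvgr_dist_lt.
rewrite -rmorphB normc_def /= expr0n addr0 sqrtr_sqr eE ltcR.
exact: ab.
Unshelve. all: by end_near. Qed.

Theorem theorem1p1 (R : realType) (X : metricType R) (T : X -> X) :
  topological_dynamical_system T ->
  has_one_sided_horseshoe T \/ has_two_sided_horseshoe T ->
  Bohr_chaotic T.
Proof.
move=> [_ cT] /horseshoe_two_sided_map[m [G [m0 cG GT G_unit]]] w w_nontrivial.
have [f [P [cf P0 fP]]] := residue_detector cT cG m0 GT G_unit.
have [r [t /limn_esup_gt0P[c c0 cP]]] := nontrivial_weight_residue P0 w_nontrivial.
(* Along the orbit, [f] will be the indicator of these times, so the weighted sum keeps only terms
   with positive signed part. *)
pose S n := [&& (n %% P)%N == r & 0 < signed_part t (w n)].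
have [|x xP] := fP r S (ltn_ord r); first by move=> n /andP[/eqP].
exists (fun y => (f y)%:C%C), x; split.
  by move=> y; apply: continuous_comp; [exact: cf|exact: real_complex_continuous].
apply/limn_esup_gt0P; exists c => // n; have [k nk ck] := cP n; exists k => //.
apply: le_trans ck _; rewrite ler_wpM2l ?invr_ge0 //.
apply: le_trans (le_cmod_sum_signed_part t w S k) _.
by under [X in _ <= cmod X]eq_bigr do rewrite xP.
Qed.
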